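(* Let $\mathcal{G}=\langle\mathcal{S}\mid\mathcal{R}\rangle$ be a presented connected groupoid, with each relation in $\mathcal{R}$ written in the form $s_1^{\varepsilon_1}\cdots s_k^{\varepsilon_k}=1_u$ with $s_i\in\mathcal{S}$ and $\varepsilon_i\in\{\pm1\}$. Let $\varphi:\mathcal{F}(\mathcal{S})\to\mathcal{G}$ be the quotient functor from the free groupoid on $\mathcal{S}$, let $u_0$ be an object, and let $\{m_v\}_{v}$ be a Schreier transversal of $\mathcal{F}(\mathcal{S})$ rooted in $u_0$. For $s\in\mathcal{S}$ with source $u$ and target $v$ put $\gamma(s)=m_u\,s\,m_v^{-1}\in\mathcal{F}(\mathcal{S})(u_0,u_0)$, and let $S_1$ be the set of all elements $\gamma(s)\neq 1_{u_0}$, $s\in\mathcal{S}$. Let $S^*$ be a set of symbols $\gamma(s)^*$ in one-to-one correspondence with the elements $\gamma(s)$ of $S_1$, and let $R^*$ be the set of all relations $$(\gamma(s_1)^* )^{\varepsilon_1}\cdots(\gamma(s_k)^* )^{\varepsilon_k}=1,$$ where $s_1^{\varepsilon_1}\cdots s_k^{\varepsilon_k}=1_u$ is in $\mathcal{R}$. Then the map $S^*\to\mathcal{G}(u_0,u_0)$ sending $\gamma(s)^*$ to $\varphi(\gamma(s))$ induces an isomorphism of groups between $G^*=\langle S^*\mid R^*\rangle$ and $\mathcal{G}(u_0,u_0)$.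
   Context: $\mathcal{S}$ is an oriented graph (a set of objects, a set of arrows with source and target; loops and multiple arrows allowed). Paths are composed from left to right: $fg$ means first $f$, then $g$. $\mathcal{F}(\mathcal{S})$ is the free groupoid on $\mathcal{S}$; each of its morphisms is represented by a unique reduced path in $\mathcal{S}\sqcup\mathcal{S}^{-1}$ (no subpath $ss^{-1}$ or $s^{-1}s$). $\langle\mathcal{S}\mid\mathcal{R}\rangle$ is the quotient of $\mathcal{F}(\mathcal{S})$ by the relations $\mathcal{R}$ (pairs of morphisms with the same source and target). A Schreier transversal of $\mathcal{F}(\mathcal{S})$ rooted in $u_0$ is a family of reduced paths $\{m_v\}$, indexed by the objects $v$, such that $m_v$ has source $u_0$ and target $v$ for every $v$, and the family is stable under taking prefixes (in particular $m_{u_0}=1_{u_0}$). In $R^*$, if $\gamma(s)=1_{u_0}$ then $\gamma(s)^*$ is read as the identity element $1$. *)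

(* Defs.v *)
From HB Require Import structures.
From Stdlib Require Import Relation_Operators.
From mathcomp Require Import all_boot.
From mathcomp Require Import boolp.

Set Implicit Arguments.
Unset Strict Implicit.
Unset Printing Implicit Defensive.

Local Open Scope quotient_scope.

(* Quotient of a type by the equivalence relation generated by [e]. *)
Section Quotient.
Variables (T : Type) (e : T -> T -> Prop).

Definition gen_equiv : rel {classic T} :=
  fun x y => `[< clos_refl_sym_trans T e x y >].

Lemma gen_equiv_refl : reflexive gen_equiv.
Proof. by move=> x; apply/asboolP; apply: rst_refl. Qed.

Lemma gen_equiv_sym : symmetric gen_equiv.
Proof. by move=> x y; apply/asboolP/asboolP; apply: rst_sym. Qed.

Lemma gen_equiv_trans : transitive gen_equiv.
Proof.
move=> y x z /asboolP xy /asboolP yz; apply/asboolP; exact: rst_trans xy yz.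
Qed.

Canonical gen_equiv_rel :=
  EquivRel gen_equiv gen_equiv_refl gen_equiv_sym gen_equiv_trans.

Definition quot : Type := {eq_quot gen_equiv_rel}.
Definition class_of (x : T) : quot := \pi_({eq_quot gen_equiv_rel}) x.
Definition repr_of (q : quot) : T := repr (q : {eq_quot gen_equiv_rel}).

Lemma repr_ofK q : class_of (repr_of q) = q.
Proof. exact: reprK. Qed.

Lemma class_ofP x y :
  class_of x = class_of y <-> clos_refl_sym_trans T e x y.
Proof.
split=> [/eqmodP/asboolP // | h].
by apply/eqmodP; apply/asboolP.
Qed.

Lemma class_of_reprP x : clos_refl_sym_trans T e (repr_of (class_of x)) x.
Proof. by apply/class_ofP; rewrite repr_ofK. Qed.

End Quotient.

Lemma rst_map (T U : Type) (e : T -> T -> Prop) (e' : U -> U -> Prop)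
    (f : T -> U) :
  (forall x y, e x y -> clos_refl_sym_trans U e' (f x) (f y)) ->
  forall x y, clos_refl_sym_trans T e x y ->
    clos_refl_sym_trans U e' (f x) (f y).
Proof.
move=> H x y; elim=> {x y} [x y /H //|x|x y _|x y z _ IH1 _ IH2].
- exact: rst_refl.
- exact: rst_sym.
- exact: rst_trans IH1 IH2.
Qed.

(* [gcomp f g] is the left-to-right composite fg: first f, then g. *)
Record groupoid := Groupoid {
  gobj : Type;
  ghom : gobj -> gobj -> Type;
  gid : forall u, ghom u u;
  gcomp : forall u v w, ghom u v -> ghom v w -> ghom u w;
  ginv : forall u v, ghom u v -> ghom v u;
  gcompA : forall u v w x (f : ghom u v) (g : ghom v w) (h : ghom w x),
    gcomp f (gcomp g h) = gcomp (gcomp f g) h;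
  gcomp1l : forall u v (f : ghom u v), gcomp (gid u) f = f;
  gcomp1r : forall u v (f : ghom u v), gcomp f (gid v) = f;
  gcompVl : forall u v (f : ghom u v), gcomp (ginv f) f = gid v;
  gcompVr : forall u v (f : ghom u v), gcomp f (ginv f) = gid u
}.

Arguments ghom : clear implicits.
Arguments gid : clear implicits.

Definition connected (G : groupoid) : Prop :=
  forall u v : gobj G, inhabited (ghom G u v).

Definition vertex_group (G : groupoid) (u : gobj G) : Type := ghom G u u.

Section VertexGroup.
Variables (G : groupoid) (u : gobj G).

HB.instance Definition _ := gen_eqMixin (vertex_group u).
HB.instance Definition _ := gen_choiceMixin (vertex_group u).
HB.instance Definition _ := isGroup.Build (vertex_group u)
  (fun f g h => @gcompA G u u u u f g h) (@gcomp1l G u u) (@gcomp1r G u u)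
  (@gcompVl G u u) (@gcompVr G u u).

End VertexGroup.

(* Quotient of a groupoid by a family [E] of pairs of parallel morphisms. *)
Section GroupoidQuotient.
Variables (G : groupoid).
Variable E : forall u v, ghom G u v -> ghom G u v -> Prop.

Inductive rel_step u v : ghom G u v -> ghom G u v -> Prop :=
  RelStep a b (f : ghom G u a) (x y : ghom G a b) (g : ghom G b v) :
    E x y -> rel_step (gcomp (gcomp f x) g) (gcomp (gcomp f y) g).

Definition qhom u v := quot (@rel_step u v).

(* The quotient functor; it is the identity on objects. *)
Definition gproj u v (f : ghom G u v) : qhom u v := class_of (@rel_step u v) f.

Definition qcomp u v w (f : qhom u v) (g : qhom v w) : qhom u w :=
  gproj (gcomp (repr_of f) (repr_of g)).

Definition qinv u v (f : qhom u v) : qhom v u := gproj (ginv (repr_of f)).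

Lemma gproj_comp u v w (f : ghom G u v) (g : ghom G v w) :
  qcomp (gproj f) (gproj g) = gproj (gcomp f g).
Proof.
apply/class_ofP.
apply: (@rst_trans _ _ _ (gcomp f (repr_of (gproj g)))).
  apply: (rst_map (f := fun h => gcomp h _) _ (class_of_reprP _ _)).
  move=> _ _ [a b h x y k Exy]; apply: rst_step.
  by rewrite -!gcompA !(gcompA h); apply: RelStep.
apply: (rst_map (f := gcomp f) _ (class_of_reprP _ _)).
move=> _ _ [a b h x y k Exy]; apply: rst_step.
by rewrite !gcompA; apply: RelStep.
Qed.

Lemma ginv_uniq u v (f : ghom G u v) g : gcomp f g = gid G u -> g = ginv f.
Proof. by move=> fg1; rewrite -[g]gcomp1l -(gcompVl f) -gcompA fg1 gcomp1r. Qed.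

Lemma gproj_inv u v (f : ghom G u v) : qinv (gproj f) = gproj (ginv f).
Proof.
pose g := repr_of (gproj f).
have gf : gproj g = gproj f by exact: repr_ofK.
rewrite /qinv -/g -[ginv g]gcomp1r -(gcompVr f) gcompA.
rewrite -gproj_comp -(gproj_comp (ginv g) f) -gf gproj_comp gcompVl.
by rewrite gproj_comp gcomp1l.
Qed.

Lemma gprojK u v (f : qhom u v) : gproj (repr_of f) = f.
Proof. exact: repr_ofK. Qed.

Lemma qcompA u v w x (f : qhom u v) (g : qhom v w) (h : qhom w x) :
  qcomp f (qcomp g h) = qcomp (qcomp f g) h.
Proof.
by rewrite -[f]gprojK -[g]gprojK -[h]gprojK !gproj_comp gcompA.
Qed.

Lemma qcomp1l u v (f : qhom u v) : qcomp (gproj (gid G u)) f = f.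
Proof. by rewrite -[f]gprojK gproj_comp gcomp1l. Qed.

Lemma qcomp1r u v (f : qhom u v) : qcomp f (gproj (gid G v)) = f.
Proof. by rewrite -[f]gprojK gproj_comp gcomp1r. Qed.

Lemma qcompVl u v (f : qhom u v) : qcomp (qinv f) f = gproj (gid G v).
Proof. by rewrite -[f]gprojK gproj_inv gproj_comp gcompVl. Qed.

Lemma qcompVr u v (f : qhom u v) : qcomp f (qinv f) = gproj (gid G u).
Proof. by rewrite -[f]gprojK gproj_inv gproj_comp gcompVr. Qed.

Definition gquot : groupoid :=
  @Groupoid (gobj G) qhom (fun u => gproj (gid G u)) qcomp qinv
    qcompA qcomp1l qcomp1r qcompVl qcompVr.

End GroupoidQuotient.

(* Oriented graphs; loops and multiple arrows are allowed.  The set of all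
   arrows is the disjoint union of the [arr u v]. *)
Record graph := Graph { obj : Type; arr : obj -> obj -> Type }.

Arguments arr : clear implicits.

(* The arrows u -> v of S and S^-1 together. *)
Inductive letter (S : graph) (u v : obj S) : Type :=
  | Pos of arr S u v
  | Neg of arr S v u.

Arguments Pos {S u v} _.
Arguments Neg {S u v} _.

Definition linv (S : graph) (u v : obj S) (l : letter u v) : letter v u :=
  match l with Pos s => Neg s | Neg s => Pos s end.

(* Paths, not necessarily reduced, in S and S^-1. *)
Inductive gpath (S : graph) : obj S -> obj S -> Type :=
  | pnil u : gpath u u
  | pcons u v w : letter u v -> gpath v w -> gpath u w.

Arguments pnil {S} u.

Definition pone (S : graph) (u v : obj S) (l : letter u v) : gpath u v :=
  pcons l (pnil v).

Fixpoint pcat (S : graph) (u v w : obj S) (p : gpath u v) :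
    gpath v w -> gpath u w :=
  match p in gpath u v return gpath v w -> gpath u w with
  | pnil _ => fun q => q
  | pcons _ _ _ l p' => fun q => pcons l (pcat p' q)
  end.

Fixpoint pinv (S : graph) (u v : obj S) (p : gpath u v) : gpath v u :=
  match p with
  | pnil u => pnil u
  | pcons _ _ _ l p' => pcat (pinv p') (pone (linv l))
  end.

Definition reduced (S : graph) (u v : obj S) (p : gpath u v) : Prop :=
  forall a b (p1 : gpath u a) (l : letter a b) (p2 : gpath a v),
    p <> pcat p1 (pcons l (pcons (linv l) p2)).

(* The morphisms of the free groupoid are the classes of paths modulo insertion
   and deletion of subpaths l l^-1; each class contains one reduced path. *)
Section FreeGroupoid.
Variable S : graph.

Inductive cancel_step (u v : obj S) : gpath u v -> gpath u v -> Prop :=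
  CancelStep a b (p1 : gpath u a) (l : letter a b) (p2 : gpath a v) :
    cancel_step (pcat p1 (pcons l (pcons (linv l) p2))) (pcat p1 p2).

Definition fhom (u v : obj S) := quot (@cancel_step u v).

Definition fclass (u v : obj S) (p : gpath u v) : fhom u v :=
  class_of (@cancel_step u v) p.

Definition fcomp u v w (f : fhom u v) (g : fhom v w) : fhom u w :=
  fclass (pcat (repr_of f) (repr_of g)).

Definition finv u v (f : fhom u v) : fhom v u := fclass (pinv (repr_of f)).

Lemma pcatA (u v w x : obj S)
    (p : gpath u v) (q : gpath v w) (r : gpath w x) :
  pcat p (pcat q r) = pcat (pcat p q) r.
Proof. by elim: p q => //= {}u {}v y l p IH q; rewrite IH. Qed.

Lemma pcat0r (u v : obj S) (p : gpath u v) : pcat p (pnil v) = p.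
Proof. by elim: p => //= {}u {}v w l p ->. Qed.

Lemma linvK (u v : obj S) (l : letter u v) : linv (linv l) = l.
Proof. by case: l. Qed.

Lemma pinv_cat (u v w : obj S) (p : gpath u v) (q : gpath v w) :
  pinv (pcat p q) = pcat (pinv q) (pinv p).
Proof.
elim: p q => [{}u|{}u {}v y l p IH] q /=; first by rewrite pcat0r.
by rewrite IH pcatA.
Qed.

Lemma fclassK u v (f : fhom u v) : fclass (repr_of f) = f.
Proof. exact: repr_ofK. Qed.

Lemma fclass_cat u v w (p : gpath u v) (q : gpath v w) :
  fcomp (fclass p) (fclass q) = fclass (pcat p q).
Proof.
apply/class_ofP.
apply: (@rst_trans _ _ _ (pcat p (repr_of (fclass q)))).
  apply: (rst_map (f := fun r => pcat r _) _ (class_of_reprP _ _)).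
  move=> _ _ [a b p1 l p2]; apply: rst_step.
  by rewrite -!pcatA /=; apply: CancelStep.
apply: (rst_map (f := pcat p) _ (class_of_reprP _ _)).
move=> _ _ [a b p1 l p2]; apply: rst_step.
by rewrite !pcatA; apply: CancelStep.
Qed.

Lemma fclass_inv u v (p : gpath u v) : finv (fclass p) = fclass (pinv p).
Proof.
apply/class_ofP; apply: (rst_map (f := @pinv S u v) _ (class_of_reprP _ _)).
move=> _ _ [a b p1 l p2]; apply: rst_step.
rewrite !pinv_cat /= linvK -!pcatA /=.
have := CancelStep (pinv p2) l (pinv p1).
by [].
Qed.

Lemma fclass_catV u v (p : gpath u v) :
  fclass (pcat p (pinv p)) = fclass (pnil u).
Proof.
elim: p => [//|{}u {}v w l p IH] /=.
rewrite -[pcons l _]/(pcat (pone l) (pcat p (pcat (pinv p) (pone (linv l))))).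
rewrite (pcatA p) -fclass_cat -(fclass_cat _ (pone (linv l))) IH.
rewrite !fclass_cat /=; apply/class_ofP/rst_step.
exact: (CancelStep (pnil u) l (pnil u)).
Qed.

Lemma pinvK (u v : obj S) (p : gpath u v) : pinv (pinv p) = p.
Proof. by elim: p => //= {}u {}v w l p IH; rewrite pinv_cat IH /= linvK. Qed.

Lemma fcompA u v w x (f : fhom u v) (g : fhom v w) (h : fhom w x) :
  fcomp f (fcomp g h) = fcomp (fcomp f g) h.
Proof. by rewrite -[f]fclassK -[g]fclassK -[h]fclassK !fclass_cat pcatA. Qed.

Lemma fcomp1l u v (f : fhom u v) : fcomp (fclass (pnil u)) f = f.
Proof. by rewrite -[f]fclassK fclass_cat. Qed.

Lemma fcomp1r u v (f : fhom u v) : fcomp f (fclass (pnil v)) = f.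
Proof. by rewrite -[f]fclassK fclass_cat pcat0r. Qed.

Lemma fcompVr u v (f : fhom u v) : fcomp f (finv f) = fclass (pnil u).
Proof. by rewrite -[f]fclassK fclass_inv fclass_cat fclass_catV. Qed.

Lemma fcompVl u v (f : fhom u v) : fcomp (finv f) f = fclass (pnil v).
Proof.
rewrite -[f]fclassK fclass_inv fclass_cat.
by rewrite -{2}[repr_of f]pinvK fclass_catV.
Qed.

Definition free_groupoid : groupoid :=
  @Groupoid (obj S) fhom (fun u => fclass (pnil u)) fcomp finv
    fcompA fcomp1l fcomp1r fcompVl fcompVr.

End FreeGroupoid.

(* A set of relations of the form s_1^e_1 ... s_k^e_k = 1_u is given by the
   set of its left-hand sides, which are closed paths taken letter by letter,
   without reduction. *)
Definition relators (S : graph) := forall u : obj S, gpath u u -> Prop.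

Inductive relator_eq (S : graph) (R : relators S) :
    forall u v, ghom (free_groupoid S) u v -> ghom (free_groupoid S) u v ->
      Prop :=
  RelatorEq u (w : gpath u u) :
    R u w -> relator_eq R (fclass w) (gid (free_groupoid S) u).

Definition presented (S : graph) (R : relators S) : groupoid :=
  gquot (@relator_eq S R).

Definition quotient_functor (S : graph) (R : relators S) (u v : obj S)
    (f : ghom (free_groupoid S) u v) : ghom (presented R) u v :=
  gproj (@relator_eq S R) f.

(* Groups are groupoids with one object: a group presentation <X | R> is a
   presentation on the graph with one object and set of loops X. *)
Definition bouquet (X : Type) : graph := @Graph unit (fun _ _ => X).

Definition base (X : Type) : obj (bouquet X) := tt.

Definition loop (X : Type) (x : X) : gpath (base X) (base X) :=
  pone (Pos (x : arr (bouquet X) (base X) (base X))).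

Definition presented_group (X : Type) (R : relators (bouquet X)) : groupType :=
  @vertex_group (presented R) (base X).

Definition pgen (X : Type) (R : relators (bouquet X)) (x : X) :
    presented_group R :=
  quotient_functor R (fclass (loop x)).

Section Transversal.
Variables (S : graph) (u0 : obj S) (m : forall v, gpath u0 v).

(* A prefix with target w can only be the member of the family indexed by w. *)
Definition schreier_transversal : Prop :=
  (forall v, reduced (m v)) /\
  (forall v w (p : gpath u0 w) (q : gpath w v), m v = pcat p q -> p = m w).

(* gamma(s) = m_u s m_v^-1 in the free groupoid. *)
Definition tgamma (u v : obj S) (s : arr S u v) :
    ghom (free_groupoid S) u0 u0 :=
  let F := free_groupoid S in
  @gcomp F _ _ _ (@gcomp F _ _ _ (fclass (m u)) (fclass (pone (Pos s))))
    (@ginv F _ _ (fclass (m v))).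

Definition in_S1 (g : ghom (free_groupoid S) u0 u0) : Prop :=
  (exists u v (s : arr S u v), g = tgamma s) /\ g <> gid (free_groupoid S) u0.

Definition S1 : Type := {g : ghom (free_groupoid S) u0 u0 | in_S1 g}.

Lemma in_S1_tgamma (u v : obj S) (s : arr S u v) :
  tgamma s <> gid (free_groupoid S) u0 -> in_S1 (tgamma s).
Proof. by move=> h; split=> //; exists u, v, s. Qed.

Variables (Sstar : Type) (star : S1 -> Sstar).

(* gamma(s)^*, read as the empty path when gamma(s) = 1. *)
Definition star_arrow (u v : obj S) (s : arr S u v) :
    gpath (base Sstar) (base Sstar) :=
  match pselect (tgamma s <> gid (free_groupoid S) u0) with
  | left h => loop (star (exist _ _ (in_S1_tgamma h)))
  | right _ => pnil (base Sstar)
  end.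

Definition star_letter (u v : obj S) (l : letter u v) :
    gpath (base Sstar) (base Sstar) :=
  match l with Pos s => star_arrow s | Neg s => pinv (star_arrow s) end.

Fixpoint star_path (u v : obj S) (p : gpath u v) :
    gpath (base Sstar) (base Sstar) :=
  match p with
  | pnil _ => pnil (base Sstar)
  | pcons _ _ _ l p' => pcat (star_letter l) (star_path p')
  end.

Inductive star_relators (R : relators S) :
    forall u : obj (bouquet Sstar), gpath u u -> Prop :=
  StarRelator u (w : gpath u u) :
    R u w -> @star_relators R (base Sstar) (star_path w).

End Transversal.

(* Main.v *)
Require Import Defs.
From HB Require Import structures.
From Stdlib Require Import Relation_Operators.
From mathcomp Require Import all_boot.
From mathcomp Require Import boolp.

(* By the universal property of presentations, the symbols gamma(s)^* extend to
   a morphism F : G^* -> G(u0, u0), and s |-> gamma(s)^* extends to a functor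
   H : G -> G^*.  For a path p from u to v, telescoping gives
   F (H p) = m_u p m_v^-1, which is p itself when u = v = u0, as m_u0 = 1.
   Conversely, every letter s of a transversal path m_v satisfies gamma(s) = 1,
   because the prefixes of m_v are themselves in the transversal; so H m_v = 1
   and H (gamma(s)) = gamma(s)^*, that is H (F x) = x on generators. *)

Set Implicit Arguments.
Unset Strict Implicit.
Unset Printing Implicit Defensive.

(** * Cancellation and inverses in a groupoid *)

Section GroupoidTheory.
Variable G : groupoid.

Lemma gcompKl u v w (f : ghom G u v) (g : ghom G v w) :
  gcomp (ginv f) (gcomp f g) = g.
Proof. by rewrite gcompA gcompVl gcomp1l. Qed.

Lemma gcompVKl u v w (f : ghom G v u) (g : ghom G v w) :
  gcomp f (gcomp (ginv f) g) = g.
Proof. by rewrite gcompA gcompVr gcomp1l. Qed.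

Lemma ginvK u v (f : ghom G u v) : ginv (ginv f) = f.
Proof. by symmetry; apply: ginv_uniq; exact: gcompVl. Qed.

Lemma ginv1 u : ginv (gid G u) = gid G u.
Proof. by symmetry; apply: ginv_uniq; exact: gcomp1l. Qed.

Lemma ginvM u v w (f : ghom G u v) (g : ghom G v w) :
  ginv (gcomp f g) = gcomp (ginv g) (ginv f).
Proof.
by symmetry; apply: ginv_uniq; rewrite -gcompA gcompVKl gcompVr.
Qed.

End GroupoidTheory.

(** * Morphisms of a presented groupoid as classes of paths *)

Section PathClass.
Variables (S : graph) (R : relators S).

Definition pclass u v (p : gpath u v) : ghom (presented R) u v :=
  quotient_functor R (fclass p).

Definition prepr u v (x : ghom (presented R) u v) : gpath u v :=
  Defs.repr_of (Defs.repr_of (x : qhom (@relator_eq S R) u v) : fhom u v).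

Lemma preprK u v (x : ghom (presented R) u v) : pclass (prepr x) = x.
Proof. rewrite /pclass /prepr fclassK; exact: gprojK. Qed.

Lemma pclass_surj u v (x : ghom (presented R) u v) : exists p, x = pclass p.
Proof. by exists (prepr x); rewrite preprK. Qed.

Lemma pclass_nil u : pclass (pnil u) = gid (presented R) u.
Proof. by []. Qed.

Lemma pclass_cat u v w (p : gpath u v) (q : gpath v w) :
  pclass (pcat p q) = gcomp (pclass p) (pclass q).
Proof.
by rewrite /pclass -fclass_cat; symmetry; exact: gproj_comp.
Qed.

Lemma pclass_inv u v (p : gpath u v) : pclass (pinv p) = ginv (pclass p).
Proof. by rewrite /pclass -fclass_inv; symmetry; exact: gproj_inv. Qed.

Lemma pclass_relator u (w : gpath u u) :
  R w -> pclass w = gid (presented R) u.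
Proof.
move=> Rw; apply/class_ofP/rst_step.
have := RelStep (gid (free_groupoid S) u) (gid (free_groupoid S) u)
  (RelatorEq Rw).
by rewrite !(gcomp1l, gcomp1r).
Qed.

End PathClass.

(** * Universal property of a presented groupoid *)

Section UniversalProperty.
Variables (S : graph) (G : groupoid) (o : obj S -> gobj G).
Variable a : forall u v, arr S u v -> ghom G (o u) (o v).

Definition leval u v (l : letter u v) : ghom G (o u) (o v) :=
  match l with Pos s => a s | Neg s => ginv (a s) end.

Fixpoint peval u v (p : gpath u v) : ghom G (o u) (o v) :=
  match p with
  | pnil u => gid G (o u)
  | pcons _ _ _ l p' => gcomp (leval l) (peval p')
  end.

Lemma leval_linv u v (l : letter u v) : leval (linv l) = ginv (leval l).
Proof. by case: l => s //=; rewrite ginvK. Qed.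

Lemma peval_cat u v w (p : gpath u v) (q : gpath v w) :
  peval (pcat p q) = gcomp (peval p) (peval q).
Proof.
elim: p q => [{}u|{}u {}v y l p IH] q /=; first by rewrite gcomp1l.
by rewrite IH gcompA.
Qed.

Lemma peval_pone u v (l : letter u v) : peval (pone l) = leval l.
Proof. exact: gcomp1r. Qed.

Lemma peval_inv u v (p : gpath u v) : peval (pinv p) = ginv (peval p).
Proof.
elim: p => [{}u|{}u {}v y l p IH] /=; first by rewrite ginv1.
by rewrite peval_cat /= gcomp1r leval_linv IH ginvM.
Qed.

Lemma peval_cancel u v (p q : gpath u v) :
  fclass p = fclass q -> peval p = peval q.
Proof.
move=> /class_ofP.
elim=> {p q} [_ _ [b c p1 l p2]|//|p q _ -> //|p q r _ -> _ -> //].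
by rewrite !peval_cat /= leval_linv gcompVKl.
Qed.

Variable R : relators S.
Hypothesis aR : forall u (w : gpath u u), R w -> peval w = gid G (o u).

(** Evaluates one chosen representative path; [aR], through [plift_pclass], makes the value
    independent of that choice. *)
Definition plift u v (x : ghom (presented R) u v) : ghom G (o u) (o v) :=
  peval (prepr x).

Lemma plift_pclass u v (p : gpath u v) : plift (pclass R p) = peval p.
Proof.
have eval_repr b c (q : gpath b c) : peval (Defs.repr_of (fclass q)) = peval q.
  by apply: peval_cancel; rewrite fclassK.
have evalM b c d (f : fhom b c) (g : fhom c d) :
    peval (Defs.repr_of (fcomp f g)) =
    gcomp (peval (Defs.repr_of f)) (peval (Defs.repr_of g)).
  by rewrite eval_repr peval_cat.
rewrite /plift /prepr -[RHS]eval_repr.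
(* Induction on the chain of rewritings from the chosen representative to [fclass p]; each one
   exchanges a relator and an identity inside a context [f _ g]. *)
elim: (class_of_reprP (rel_step (@relator_eq S R) (u:=u) (v:=v)) (fclass p))
  => [_ _ [b c f x y g Exy]|//|? ? _ ->//|? ? ? _ -> _ ->//].
rewrite !evalM; congr gcomp; congr gcomp.
by case: Exy => d w Rw; rewrite eval_repr aR // eval_repr.
Qed.

Lemma pliftM u v w (x : ghom (presented R) u v) (y : ghom (presented R) v w) :
  plift (gcomp x y) = gcomp (plift x) (plift y).
Proof.
have [p ->] := pclass_surj x; have [q ->] := pclass_surj y.
by rewrite -pclass_cat !plift_pclass peval_cat.
Qed.

End UniversalProperty.

(** * Group morphisms out of a presented group *)

Lemma multiplicative1 (G H : groupType) (f : {multiplicative G -> H}) :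
  f 1%g = 1%g.
Proof. by apply: (mulgI (f 1%g)); rewrite -gmulfM !mulg1. Qed.

Lemma multiplicativeV (G H : groupType) (f : {multiplicative G -> H}) x :
  f (x^-1)%g = ((f x)^-1)%g.
Proof.
by apply: (mulgI (f x)); rewrite -gmulfM !mulgV multiplicative1.
Qed.

Lemma presented_group_ext (X : Type) (R : relators (bouquet X)) (G : groupType)
    (f g : {multiplicative presented_group R -> G}) :
  (forall x, f (pgen R x) = g (pgen R x)) -> f =1 g.
Proof.
move=> fg y; have [p ->] := pclass_surj y.
(* Path induction needs both endpoints to vary, hence the match on [unit]. *)
pose P (u v : unit) : gpath (u : obj (bouquet X)) v -> Prop :=
  match u, v return gpath (u : obj (bouquet X)) v -> Prop with
  | tt, tt => fun q => f (pclass R q) = g (pclass R q)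
  end.
suff /(_ tt tt p) : forall u v q, P u v q by [].
move=> u v; elim=> {u v} [[]|[] [] [] l q IH] /=.
  by rewrite -[pclass R _]/(1%g : presented_group R) !multiplicative1.
rewrite -[pcons l q]/(pcat (pone l) q) pclass_cat.
rewrite -[gcomp _ _]/((pclass R (pone l) : presented_group R) * pclass R q)%g.
rewrite !gmulfM; congr (_ * _)%g; last exact: IH.
case: l => x; first exact: fg.
rewrite -[pone _]/(pinv (loop x)) pclass_inv.
rewrite -[ginv _]/((pgen R x)^-1)%g !multiplicativeV; congr (_^-1)%g; exact: fg.
Qed.

(** * The symbols gamma(s)^* and their evaluation *)

Section Isomorphism.
Variables (S : graph) (R : relators S) (u0 : obj S).
Variables (m : forall v : obj S, gpath u0 v).
Variables (Sstar : Type) (star : S1 m -> Sstar) (unstar : Sstar -> S1 m).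
Hypotheses (starK : cancel star unstar) (unstarK : cancel unstar star).
Hypothesis m_prefix :
  forall v w (p : gpath u0 w) (q : gpath w v), m v = pcat p q -> p = m w.

Local Notation Rstar := (star_relators star R).

(** The empty path is a prefix of [m u0] with target [u0]. *)
Lemma transversal_root : m u0 = pnil u0.
Proof. by rewrite (m_prefix (q := m u0) (p := pnil u0)). Qed.

Lemma quotient_tgamma u v (s : arr S u v) :
  quotient_functor R (tgamma m s) =
  gcomp (gcomp (pclass R (m u)) (pclass R (pone (Pos s))))
    (ginv (pclass R (m v))).
Proof.
rewrite -pclass_inv -!pclass_cat /tgamma /=.
by rewrite fclass_inv !fclass_cat.
Qed.

Lemma star_arrow1 u v (s : arr S u v) :
  tgamma m s = gid (free_groupoid S) u0 -> star_arrow star s = pnil _.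
Proof. by rewrite /star_arrow; case: pselect. Qed.

(** [star_arrow] builds its own proof of membership in S1; by proof irrelevance any other proof
    yields the same symbol. *)
Lemma star_arrowN1 u v (s : arr S u v) (x : S1 m) :
  tgamma m s = proj1_sig x -> star_arrow star s = loop (star x).
Proof.
case: x => g g1 /= E; rewrite /star_arrow; case: pselect => [h|].
  by subst g; congr (loop (star (exist _ _ _))); apply: Prop_irrelevance.
by case; rewrite E; case: g1.
Qed.

(** Both this map and [hgen] are taken over a constant map on objects, so the universal property for
    groupoids gives values in a vertex group. *)
Definition fgen (u v : obj (bouquet Sstar)) (x : arr (bouquet Sstar) u v) :
    ghom (presented R) u0 u0 :=
  quotient_functor R (proj1_sig (unstar x)).

Definition hgen (u v : obj S) (s : arr S u v) :
    ghom (presented Rstar) (base Sstar) (base Sstar) :=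
  pclass Rstar (star_arrow star s).

Local Notation feval :=
  (@peval (bouquet Sstar) (presented R) (fun=> u0) fgen _ _).
Local Notation heval :=
  (@peval S (presented Rstar) (fun=> base Sstar) hgen _ _).

Lemma heval_star_path u v (p : gpath u v) :
  heval p = pclass Rstar (star_path star p).
Proof.
elim: p => {u v} [//|u v w l p IH] /=.
by rewrite pclass_cat IH; case: l => s //=; rewrite pclass_inv.
Qed.

Lemma feval_star_arrow u v (s : arr S u v) :
  feval (star_arrow star s) = quotient_functor R (tgamma m s).
Proof.
have [s1|sN1] := pselect (tgamma m s = gid (free_groupoid S) u0).
  by rewrite star_arrow1 // s1.
rewrite (@star_arrowN1 _ _ _ (exist _ _ (in_S1_tgamma sN1))) //.
by rewrite peval_pone /= /fgen starK.
Qed.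

Lemma feval_star_letter u v (l : letter u v) :
  feval (star_letter star l) =
  gcomp (gcomp (pclass R (m u)) (pclass R (pone l))) (ginv (pclass R (m v))).
Proof.
case: l => s /=; first by rewrite feval_star_arrow quotient_tgamma.
(* Here s goes from v to u, and inverting m_v s m_u^-1 gives m_u s^-1 m_v^-1. *)
rewrite peval_inv feval_star_arrow quotient_tgamma !ginvM ginvK gcompA.
by rewrite -pclass_inv.
Qed.

Lemma feval_star_path u v (p : gpath u v) :
  feval (star_path star p) =
  gcomp (gcomp (pclass R (m u)) (pclass R p)) (ginv (pclass R (m v))).
Proof.
elim: p => {u v} [u|u v w l p IH]; first by rewrite pclass_nil gcomp1r gcompVr.
rewrite [star_path _ _]/= peval_cat IH feval_star_letter.
rewrite -[pcons l p]/(pcat (pone l) p) pclass_cat -!gcompA.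
(* The inner factor m_v^-1 m_v cancels. *)
by rewrite gcompKl.
Qed.

Lemma feval_relator u (w : gpath u u) :
  Rstar w -> feval w = gid (presented R) u0.
Proof.
case=> v {}w Rw; rewrite feval_star_path pclass_relator //.
by rewrite gcomp1r gcompVr.
Qed.

Lemma heval_relator u (w : gpath u u) :
  R w -> heval w = gid (presented Rstar) (base Sstar).
Proof.
by move=> Rw; rewrite heval_star_path pclass_relator //; exact: StarRelator.
Qed.

(** * The morphisms F and H between the two groups *)

Definition fiso (x : presented_group Rstar) :
    vertex_group (G := presented R) u0 :=
  @plift (bouquet Sstar) (presented R) (fun=> u0) fgen Rstar _ _ x.

Lemma fisoM : {morph fiso : x y / (x * y)%g}.
Proof. by move=> x y; apply: pliftM; exact: feval_relator. Qed.

HB.instance Definition _ := isMultiplicative.Build _ _ fiso fisoM.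

Definition fiso_morphism :
  {multiplicative presented_group Rstar ->
                  vertex_group (G := presented R) u0} :=
  fiso.

Lemma fiso_pgen (x : S1 m) :
  fiso (pgen Rstar (star x)) = quotient_functor R (proj1_sig x).
Proof.
rewrite /fiso plift_pclass; last exact: feval_relator.
by rewrite peval_pone /= /fgen starK.
Qed.

Definition fiso_inv (y : vertex_group (G := presented R) u0) :
    presented_group Rstar :=
  @plift S (presented Rstar) (fun=> base Sstar) hgen R _ _ y.

Lemma fiso_invM : {morph fiso_inv : x y / (x * y)%g}.
Proof. by move=> x y; apply: pliftM; exact: heval_relator. Qed.

HB.instance Definition _ := isMultiplicative.Build _ _ fiso_inv fiso_invM.

(** * Triviality of the symbols along the transversal *)

(** Both [p] and [p] followed by [l] are prefixes of [m v], so they are [m a] and [m b]. *)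
Lemma transversal_letter v a b (p : gpath u0 a) (l : letter a b)
    (q : gpath b v) :
  m v = pcat p (pcons l q) -> pcat (m a) (pone l) = m b.
Proof.
move=> E; rewrite -(m_prefix E); apply: m_prefix (q) _.
by rewrite -pcatA.
Qed.

Lemma star_letter_transversal a b (l : letter a b) :
  pcat (m a) (pone l) = m b -> star_letter star l = pnil (base Sstar).
Proof.
case: l => s E /=.
  apply: star_arrow1; rewrite /tgamma /= fclass_cat E fclass_inv fclass_cat.
  exact: fclass_catV.
(* Now m_b = m_a s^-1 with s from b to a, so gamma(s) = m_a s^-1 s m_a^-1 = 1. *)
suff s1 : tgamma m s = gid (free_groupoid S) u0 by rewrite star_arrow1.
have mb : fclass (m b) = @gcomp (free_groupoid S) _ _ _ (fclass (m a))
    (@ginv (free_groupoid S) _ _ (fclass (pone (Pos s)))).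
  by rewrite -E /= fclass_inv fclass_cat.
by rewrite /tgamma mb -!gcompA gcompKl gcompVr.
Qed.

(** Stated for suffixes so that induction on [q] can move its first letter to the end of [p]. *)
Lemma star_path_suffix a v (p : gpath u0 a) (q : gpath a v) :
  m v = pcat p q -> star_path star q = pnil (base Sstar).
Proof.
elim: q p => {a v} [//|a b v l q IH] p E /=.
rewrite (star_letter_transversal (transversal_letter E)) /=.
by apply: (IH (pcat p (pone l))); rewrite -pcatA.
Qed.

Lemma star_path_transversal v : star_path star (m v) = pnil (base Sstar).
Proof. exact: (@star_path_suffix u0 v (pnil u0)). Qed.

(** * The two composites *)

Lemma fisoK : cancel fiso fiso_inv.
Proof.
apply: (@presented_group_ext _ _ _ (fiso_inv \o fiso) idfun) => x /=.
rewrite -[x]unstarK fiso_pgen; case: (unstar x) => g gS1 /=.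
have [[u [v [s Eg]]] _] := gS1.
have -> : quotient_functor R g =
    pclass R (pcat (pcat (m u) (pone (Pos s))) (pinv (m v))).
  by rewrite Eg quotient_tgamma !pclass_cat pclass_inv.
rewrite /fiso_inv plift_pclass; last exact: heval_relator.
(* The outer factors m_u and m_v^-1 have trivial image, so only gamma(s)^* remains. *)
rewrite !peval_cat peval_inv !heval_star_path !star_path_transversal.
rewrite pclass_nil ginv1 gcomp1l gcomp1r /= pcat0r.
by rewrite (@star_arrowN1 _ _ _ (exist _ g gS1)).
Qed.

Lemma fiso_invK : cancel fiso_inv fiso.
Proof.
move=> y; have [p ->] := pclass_surj y.
rewrite /fiso_inv plift_pclass; last exact: heval_relator.
rewrite heval_star_path /fiso plift_pclass; last exact: feval_relator.
(* For a closed path at [u0] the conjugating factors are [m u0], which is empty. *)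
rewrite feval_star_path transversal_root.
by rewrite pclass_nil ginv1 gcomp1l gcomp1r.
Qed.

End Isomorphism.

Theorem proposition6 (S : graph) (R : relators S) (u0 : obj S)
    (m : forall v : obj S, gpath u0 v)
    (Sstar : Type) (star : S1 m -> Sstar) :
  connected (presented R) ->
  schreier_transversal m ->
  bijective star ->
  let Gstar := presented_group (star_relators star R) in
  let Gu0 := @vertex_group (presented R) u0 in
  exists f : {multiplicative Gstar -> Gu0},
    [/\ forall x : S1 m,
          f (pgen (star_relators star R) (star x)) =
          quotient_functor R (proj1_sig x),
        forall g : {multiplicative Gstar -> Gu0},
          (forall x : S1 m,
             g (pgen (star_relators star R) (star x)) =
             quotient_functor R (proj1_sig x)) ->
          g =1 f
      & bijective f].
Proof.
move=> _ [_ m_prefix] [unstar starK unstarK] Gstar Gu0.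
exists (fiso_morphism R starK); split=> [x|g gstar|].
- exact: fiso_pgen.
(* Since [star] is onto, its values exhaust the generators of G^*. *)
- apply: presented_group_ext => x.
  by rewrite -[x]unstarK gstar [RHS]fiso_pgen.
- exact: Bijective (fisoK starK unstarK m_prefix) (fiso_invK starK m_prefix).
Qed.
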